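(* Let $(H_w,H_r)$ be a target pair and let $n\ge 3$ be a $w$-vertex such that $$\bar H_r(2)<H_w(n)-(n-2)H_w(1).$$ Write $H=H_w(n)$ and $\rho_1=H_r(1)$ ($\rho_1=0$ when $b_r=0$). If the pair is realizable, or if it satisfies exchange closure (EC), then $$\bar H_w(m+1)\ \ge\ H_r(m)+\min\left\{\frac Hn,\frac{H-\rho_1}{n-1}\right\}\qquad(0\le m\le b_r).$$
   Context: Instances and realizability. An instance consists of a finite set $E$ of items with rational values $a_i\ge 0$, positive integer sizes $d_i$, and integer capacities $0\le R<D$, with $d_i\le D$ for every item. Write $G(S)=\sum_{i\in S}a_i$ and $d(S)=\sum_{i\in S}d_i$. For $\alpha\in\{w,r\}$ let $U^\alpha(n)$ be the maximum of $G(S)$ over $n$-element sets $S\subseteq E$ with $d(S)\le D$ (for $\alpha=w$) or $d(S)\le R$ (for $\alpha=r$), with value $-\infty$ if there is none; $U^\alpha(0)=0$. The terminal count is $b_\alpha=\min\operatorname{arg\,max}_n U^\alpha(n)$. The hull is the sequence on $\{0,\dots,b_\alpha\}$ obtained by evaluating at integers the upper concave hull of the points $(n,U^\alpha(n))$, $0\le n\le b_\alpha$. A target pair $(H_w,H_r)$ consists of strictly increasing concave rational sequences $H_\alpha$ on $\{0,\dots,b_\alpha\}$ with $H_\alpha(0)=0$ (the zero sequence $(0)$, with $b_\alpha=0$, is allowed). It is realizable if a single instance has terminal counts $b_w,b_r$ and hulls exactly $H_w$ and $H_r$. There is no cardinality cap. Notation. $\rho_m=H_r(m)-H_r(m-1)$;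 $\bar H_\alpha(k)=H_\alpha(\min\{k,b_\alpha\})$. A positive count $n\le b_\alpha$ is an $\alpha$-vertex if $n=b_\alpha$ or the slopes of $H_\alpha$ immediately before and after $n$ differ. Dominance means $H_r(k)\le\bar H_w(k)$ for $0\le k\le b_r$. Exchange closure (EC). The pair satisfies EC if dominance holds and there is an admissible witness, consisting of: for each $w$-vertex $n$, an $n$-element labeled set $X_n$ with rational values $x_{n,i}$, a long/short label for each member, and a downward-closed family $\mathcal F_n$ of subsets of $X_n$ (the declared $r$-feasible subsets) containing $\varnothing$ and whose singletons are precisely the short members; for each $r$-vertex $m$, an $m$-element set $Z_m$ with rational values $z_{m,j}$; for each such $(n,m)$, a subset $O_{n,m}\subseteq X_n$ with $O_{n,m}\in\mathcal F_n$ and a map $\pi_{n,m}:O_{n,m}\to Z_m$; such that: (EC1) $0\le x_{n,i}\le H_w(1)$, short values are at most $\rho_1$, $\sum_i x_{n,i}=H_w(n)$; every $S\subseteq X_n$ has total value at most $\bar H_w(|S|)$, and every $S\in\mathcal F_n$ has total value at most $\bar H_r(|S|)$. (EC2) $0\le z_{m,j}\le\rho_1$, $\sum_j z_{m,j}=H_r(m)$, and every $S\subseteq Z_m$ has total value at most $\bar H_r(|S|)$. (EC3) $\pi_{n,m}$ is injective, $O_{n,m}$ contains only short members, and $x_{n,i}=z_{m,\pi_{n,m}(i)}$ for $i\in O_{n,m}$. (EC4) For every $(n,m)$ and every long $i\in X_n$, with $k=|O_{n,m}|$, $\bar H_w(n-1+m-k)\ge H_w(n)-x_{n,i}+H_r(m)-\sum_{i'\in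 O_{n,m}}z_{m,\pi_{n,m}(i')}$. (EC5) For every $(n,m)$, every two-element subset $\{i,i'\}\subseteq X_n$ with $\{i,i'\}\notin\mathcal F_n$, and every $y\in X_n\setminus(\{i,i'\}\cup O_{n,m})$, $\bar H_w(m+1)\ge x_{n,y}+H_r(m)$. If $b_r=0$ there are no $r$-vertices and the conditions quantifying over $m$ are vacuous. *)

(* Defs.v *)
From HB Require Import structures.
From mathcomp Require Import all_boot all_order all_algebra.
From mathcomp Require Import constructive_ereal.
Set Implicit Arguments.
Unset Strict Implicit.
Unset Printing Implicit Defensive.
Import Order.TTheory GRing.Theory Num.Theory.
Local Open Scope ring_scope.

Record instance := Instance {
  item :> finType;
  ival : item -> rat;
  isize : item -> nat;
  capR : nat;
  capD : nat;
  ival_ge0 : forall i, 0 <= ival i;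
  isize_gt0 : forall i, (0 < isize i)%N;
  isize_leD : forall i, (isize i <= capD)%N;
  capR_ltD : (capR < capD)%N
}.

Definition total_value (I : instance) (S : {set I}) : rat :=
  \sum_(i in S) ival i.

Definition total_size (I : instance) (S : {set I}) : nat :=
  (\sum_(i in S) isize i)%N.

(* U^w is [opt_value I (capD I)] and U^r is [opt_value I (capR I)]. *)
Definition opt_value (I : instance) (c n : nat) : \bar rat :=
  \big[Order.max/-oo%E]_(S : {set I} | (#|S| == n) && (total_size S <= c)%N)
     (total_value S)%:E.

Definition argmax (U : nat -> \bar rat) (n : nat) : Prop :=
  forall k, (U k <= U n)%E.

Definition terminal_count (U : nat -> \bar rat) (b : nat) : Prop :=
  argmax U b /\ forall n, argmax U n -> (b <= n)%N.

(* The point (t, y) lies in the convex hull of the points (i, U i), i <= b.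
   Since 0 * -oo = 0 and c * -oo = -oo for c > 0, a point with U i = -oo can
   only occur with weight 0. *)
Definition in_conv (U : nat -> \bar rat) (b : nat) (t y : rat) : Prop :=
  exists l : 'I_b.+1 -> rat,
    [/\ forall i, 0 <= l i,
        \sum_i l i = 1,
        \sum_i l i * (i : nat)%:R = t
      & (\sum_i (l i)%:E * U i)%E = y%:E].

Definition upper_hull_at (U : nat -> \bar rat) (b : nat) (t h : rat) : Prop :=
  in_conv U b t h /\ forall y, in_conv U b t y -> y <= h.

(* A rational sequence on {0, ..., b} is a function nat -> rat of which only
   the values at arguments <= b are ever used. *)
Definition target_seq (b : nat) (H : nat -> rat) : Prop :=
  [/\ H 0%N = 0,
      forall k, (k < b)%N -> H k < H k.+1
    & forall k, (0 < k < b)%N -> H k.+1 - H k <= H k - H k.-1].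

Definition has_hull (U : nat -> \bar rat) (b : nat) (H : nat -> rat) : Prop :=
  terminal_count U b /\ forall k, (k <= b)%N -> upper_hull_at U b k%:R (H k).

Definition realizable (bw br : nat) (Hw Hr : nat -> rat) : Prop :=
  exists I : instance,
    has_hull (opt_value I (capD I)) bw Hw /\
    has_hull (opt_value I (capR I)) br Hr.

Definition bar (b : nat) (H : nat -> rat) (k : nat) : rat := H (minn k b).

(* The increment of H at m, set to 0 outside 1 <= m <= b; in particular
   rho_1 = 0 when b = 0. *)
Definition rho (b : nat) (H : nat -> rat) (m : nat) : rat :=
  if (m <= b)%N then H m - H m.-1 else 0.

Definition vertex (b : nat) (H : nat -> rat) (n : nat) : Prop :=
  (0 < n <= b)%N /\ (n = b \/ H n - H n.-1 <> H n.+1 - H n).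

Definition dominance (bw br : nat) (Hw Hr : nat -> rat) : Prop :=
  forall k, (k <= br)%N -> Hr k <= bar bw Hw k.

(* The labeled sets X_n and Z_m are 'I_n and 'I_m. All families are indexed by
   every natural number; only their members at vertices are constrained below.
   The domain of [wit_pi n m] is the set [wit_O n m] itself, so that the type
   is inhabited even when m = 0. *)
Record witness := Witness {
  wit_x : forall n, 'I_n -> rat;
  wit_short : forall n, pred 'I_n;
  wit_F : forall n, {set {set 'I_n}};
  wit_z : forall m, 'I_m -> rat;
  wit_O : forall n m : nat, {set 'I_n};
  wit_pi : forall n m, {i : 'I_n | i \in wit_O n m} -> 'I_m
}.

Section ExchangeClosure.
Variables (bw br : nat) (Hw Hr : nat -> rat) (W : witness).

Definition feasible_family (n : nat) : Prop :=
  [/\ set0 \in wit_F W n,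
      forall S T : {set 'I_n}, T \subset S -> S \in wit_F W n -> T \in wit_F W n
    & forall i : 'I_n, ([set i] \in wit_F W n) = wit_short W i].

Definition EC1 (n : nat) : Prop :=
  [/\ forall i : 'I_n, 0 <= wit_x W i <= Hw 1%N,
      forall i : 'I_n, wit_short W i -> wit_x W i <= rho br Hr 1,
      \sum_(i < n) wit_x W i = Hw n,
      forall S : {set 'I_n}, \sum_(i in S) wit_x W i <= bar bw Hw #|S|
    & forall S : {set 'I_n}, S \in wit_F W n ->
        \sum_(i in S) wit_x W i <= bar br Hr #|S| ].

Definition EC2 (m : nat) : Prop :=
  [/\ forall j : 'I_m, 0 <= wit_z W j <= rho br Hr 1,
      \sum_(j < m) wit_z W j = Hr m
    & forall S : {set 'I_m}, \sum_(j in S) wit_z W j <= bar br Hr #|S| ].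

Definition EC3 (n m : nat) : Prop :=
  [/\ injective (@wit_pi W n m),
      forall i : 'I_n, i \in wit_O W n m -> wit_short W i
    & forall i : {i : 'I_n | i \in wit_O W n m},
        wit_x W (sval i) = wit_z W (wit_pi i)].

(* The truncated subtraction is harmless: EC3 gives #|wit_O W n m| <= m. *)
Definition EC4 (n m : nat) : Prop :=
  forall i : 'I_n, ~~ wit_short W i ->
    Hw n - wit_x W i + Hr m
      - \sum_(i' : {i' : 'I_n | i' \in wit_O W n m}) wit_z W (wit_pi i')
    <= bar bw Hw (n.-1 + m - #|wit_O W n m|).

Definition EC5 (n m : nat) : Prop :=
  forall i i' : 'I_n, i != i' -> [set i; i'] \notin wit_F W n ->
  forall y : 'I_n, y \notin [set i; i'] :|: wit_O W n m ->
    wit_x W y + Hr m <= bar bw Hw m.+1.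

Definition admissible : Prop :=
  [/\ forall n, vertex bw Hw n -> feasible_family n /\ EC1 n,
      forall m, vertex br Hr m -> EC2 m
    & forall n m, vertex bw Hw n -> vertex br Hr m ->
        [/\ wit_O W n m \in wit_F W n, EC3 n m, EC4 n m & EC5 n m]].

End ExchangeClosure.

Definition exchange_closure (bw br : nat) (Hw Hr : nat -> rat) : Prop :=
  dominance bw br Hw Hr /\ exists W : witness, admissible bw br Hw Hr W.

(* Main.v *)
Require Import Defs.
From mathcomp Require Import all_boot all_order all_algebra.
From mathcomp Require Import constructive_ereal.
From mathcomp Require Import lra zify.
Set Implicit Arguments.
Unset Strict Implicit.
Unset Printing Implicit Defensive.
Import Order.TTheory GRing.Theory Num.Theory.
Local Open Scope ring_scope.

(** The set of [n] items behind the value [Hw n] consists of items worth at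
    most [Hw 1] each, so any two of them are worth at least
    [Hw n - (n - 2) * Hw 1], which by hypothesis exceeds what two items can be
    worth when they are r-feasible ([pair_value_ge]).  Hence no pair in this
    set is r-feasible: in an instance, any two of its items have joint size
    larger than [R].

    Let [m] be an r-vertex, attained by an r-feasible set [Z].  A member [y]
    of the [n]-set outside [Z] can be added to [Z]: since [n >= 3] there are
    two further members [i], [i'], the sizes satisfy
    [d(Z) + d_y <= R + d_y < d_i + d_i' + d_y <= D], and so
    [Hr m + x_y <= bar Hw (m + 1)].  Exchange closure states the same
    inequality abstractly in its fifth condition.  The overlap of the [n]-set
    with [Z] is r-feasible, so it has at most one element, of value at most
    [rho_1]; averaging over the remaining members gives a [y] whose value is at
    least the minimum in the theorem ([average_bound]).

    At [m = 0] the bound is [Hw n / n <= Hw 1], a consequence of concavity.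
    Between consecutive r-vertices [Hr] is affine while [bar Hw] is concave, so
    [bar Hw (m + 1) - Hr m] is concave there and cannot drop below the smaller
    of its values at the ends ([ge_of_locally_concave]). *)

(** * Concave sequences *)

Lemma slope_antitone b H i j : target_seq b H -> (i <= j < b)%N ->
  H j.+1 - H j <= H i.+1 - H i.
Proof.
move=> [_ _ conc]; elim: j => [|j IH] /andP[le_ij lt_jb].
  by have -> : i = 0%N by lia.
have [->//|ne_ij] := eqVneq i j.+1.
by apply: (le_trans (conc j.+1 _)); [lia | apply: IH; lia].
Qed.

Lemma forward_chord b H i k : target_seq b H -> (i + k <= b)%N -> (i < b)%N ->
  H (i + k)%N <= H i + k%:R * (H i.+1 - H i).
Proof.
move=> tH; elim: k => [|k IH] le_b lt_b; first by rewrite addn0 mul0r addr0.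
have := slope_antitone (i := i) (j := i + k) tH; rewrite addnS -natr1 => sl.
have := IH ltac:(lia) lt_b; have := sl ltac:(lia); lra.
Qed.

Lemma backward_chord b H i k : target_seq b H -> (i + k <= b)%N -> (0 < k)%N ->
  H i <= H (i + k)%N - k%:R * (H (i + k)%N - H (i + k).-1).
Proof.
move=> tH; elim: k i => [//|k IH] i le_b _.
have [->|k_gt0] := posnP k; first by rewrite addn1 /=; lra.
have := IH i.+1 ltac:(lia) k_gt0; rewrite addSnnS => IHi.
have := slope_antitone (i := i) (j := (i + k.+1).-1) tH ltac:(lia).
have -> : ((i + k.+1).-1.+1 = i + k.+1)%N by lia.
rewrite -natr1; lra.
Qed.

(** A vertex is an exposed point of the region below the graph.  Where the
    slopes differ their mean is a strictly supporting slope; at the right end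
    any slope below the last one is. *)
Lemma strict_support b H n : target_seq b H -> vertex b H n ->
  exists s : rat, forall i, (i <= b)%N -> i != n -> H i < H n + s * (i%:R - n%:R).
Proof.
move=> tH [/andP[n_gt0 le_nb] vn].
have [s s_lt s_gt] : exists2 s, s < H n - H n.-1 &
    (n < b)%N -> H n.+1 - H n < s.
  case: vn => [->|slopes_differ]; first by exists (H b - H b.-1 - 1); lra || lia.
  have [<-|ne_nb] := eqVneq n b; first by exists (H n - H n.-1 - 1); lra || lia.
  have lt_sl : H n.+1 - H n < H n - H n.-1.
    rewrite lt_neqAle; apply/andP; split; first by apply/eqP => /esym.
    by case: tH => _ _; apply; lia.
  by exists ((H n.+1 - H n + (H n - H n.-1)) / 2); lra.
exists s => i le_ib ne_in; case: (ltngtP i n) => [lt_in|lt_ni|eq_in].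
- have [k def_n k_gt0] : exists2 k, (n = i + k)%N & (0 < k)%N.
    by exists (n - i)%N; lia.
  have := backward_chord (i := i) (k := k) tH.
  rewrite -def_n => /(_ le_nb k_gt0).
  have : 0 < k%:R :> rat by rewrite ltr0n.
  have -> : n%:R = i%:R + k%:R :> rat by rewrite def_n natrD.
  by nra.
- have [k def_i k_gt0] : exists2 k, (i = n + k)%N & (0 < k)%N.
    by exists (i - n)%N; lia.
  have := forward_chord (i := n) (k := k) tH.
  rewrite -def_i => /(_ le_ib ltac:(lia)).
  have : 0 < k%:R :> rat by rewrite ltr0n.
  have -> : i%:R = n%:R + k%:R :> rat by rewrite def_i natrD.
  by have := s_gt ltac:(lia); nra.
- by rewrite eq_in eqxx in ne_in.
Qed.

Lemma bar_concave b H k : target_seq b H ->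
  bar b H k.+2 - bar b H k.+1 <= bar b H k.+1 - bar b H k.
Proof.
move=> tH; have [_ incr conc] := tH; rewrite /bar.
case: (ltngtP k.+1 b) => [lt_kb|lt_bk|eq_kb].
- by rewrite !(minn_idPl _); try lia; apply: (conc k.+1); lia.
- by rewrite !(minn_idPr _); try lia; lra.
- have [-> ->] : minn k.+2 b = k.+1 /\ minn k b = k by split; lia.
  by have := incr k ltac:(lia); lra.
Qed.

(** At the first point where [f] falls below [c] it has just decreased, and the
    second alternative holds there.  The decrease then propagates from each
    point to the next, up to [b], where only the first alternative is left. *)
Lemma ge_of_locally_concave (f : nat -> rat) (c : rat) b :
  c <= f 0%N ->
  (forall k, (0 < k <= b)%N ->
     c <= f k \/ ((k < b)%N /\ f k.+1 - f k <= f k - f k.-1)) ->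
  forall m, (m <= b)%N -> c <= f m.
Proof.
move=> f0 ends; elim=> [//|m IH] le_mb.
rewrite leNgt; apply/negP => lt_c.
have lt_m : f m.+1 < f m by apply: (lt_le_trans lt_c); apply: IH; lia.
have drop k : (m + k < b)%N -> f (m + k).+1 < c /\ f (m + k).+1 < f (m + k)%N.
  elim: k => [|k IHk] lt_b; first by rewrite addn0.
  have [lt_c' lt_k] := IHk ltac:(lia); rewrite addnS.
  by have [|[_ /=]] := ends (m + k).+1 ltac:(lia); lra.
have [lt_b _] := drop (b - m.+1)%N ltac:(lia).
have eq_b : (m + (b - m.+1)).+1 = b by lia.
by rewrite eq_b in lt_b; have [] := ends b ltac:(lia); [lra | lia].
Qed.

(** * Hulls of optimal values *)

Lemma opt_value_attained (I : instance) c n :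
  opt_value I c n = -oo%E \/
  exists S : {set I}, [/\ #|S| = n, (total_size S <= c)%N &
    opt_value I c n = (total_value S)%:E].
Proof.
rewrite /opt_value; elim/big_ind: _ => [|x y hx hy|S /andP[/eqP cS sS]].
- by left.
- by rewrite /Order.max; case: ifP.
- by right; exists S.
Qed.

Lemma opt_value_le_hull (I : instance) c b H k :
  has_hull (opt_value I c) b H -> (k <= b)%N ->
  (opt_value I c k <= (H k)%:E)%E.
Proof.
move=> [_ hull] le_kb; have [_ maxH] := hull k le_kb.
have [->|[S [_ _ eqU]]] := opt_value_attained I c k; first by rewrite leNye.
rewrite eqU lee_fin; apply: maxH.
have lt_kb : (k < b.+1)%N by [].
exists (fun i => (i == Ordinal lt_kb)%:R); split.
- by move=> i; rewrite ler0n.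
- rewrite (bigD1 (Ordinal lt_kb)) //= eqxx big1 ?addr0 //.
  by move=> i /negbTE ->.
- rewrite (bigD1 (Ordinal lt_kb)) //= eqxx big1 ?addr0 ?mul1r //.
  by move=> i /negbTE ->; rewrite mul0r.
- rewrite (bigD1 (Ordinal lt_kb)) //= eqxx big1 ?adde0 ?mul1e //.
  by move=> i /negbTE ->; rewrite mul0e.
Qed.

(** Beyond the terminal count the optimal value is at most the one at the
    terminal count, which is where the truncated sequence [bar b H] stays. *)
Lemma total_value_le_bar (I : instance) c b H (S : {set I}) :
  has_hull (opt_value I c) b H -> (total_size S <= c)%N ->
  total_value S <= bar b H #|S|.
Proof.
move=> hullH sS; rewrite -lee_fin.
apply: (@le_trans _ _ (opt_value I c #|S|)).
  by apply: le_bigmax_cond; rewrite eqxx.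
rewrite /bar; case: leqP => [le_b|lt_b]; first exact: (opt_value_le_hull hullH).
apply: le_trans (opt_value_le_hull hullH (leqnn b)).
by have [[amax _] _] := hullH; apply: amax.
Qed.

(** The convex combination giving [H n] has all its points on or below the graph
    of [H], hence strictly below a supporting line through [(n, H n)] except at
    [n].  All its weight is therefore at [n]. *)
Lemma vertex_attained (I : instance) c b H n :
  target_seq b H -> has_hull (opt_value I c) b H -> vertex b H n ->
  exists S : {set I}, [/\ #|S| = n, (total_size S <= c)%N & total_value S = H n].
Proof.
move=> tH hullH vn; have [/andP[_ le_nb] _] := vn.
have [s supp] := strict_support tH vn.
have [_ /(_ n le_nb) [[l [l_ge0 l_sum l_mean l_val]] _]] := hullH.
have le_H : H n <= \sum_i l i * H i.
  rewrite -lee_fin -l_val -sumEFin; apply: lee_sum => i _.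
  rewrite EFinM; apply: lee_wpmul2l; first by rewrite lee_fin.
  by apply: (opt_value_le_hull hullH); rewrite -ltnS.
have gap_ge0 (i : 'I_b.+1) : 0 <= l i * (H n + s * (i%:R - n%:R) - H i).
  apply: mulr_ge0 => //; rewrite subr_ge0.
  have [->|ne_in] := eqVneq (i : nat) n; first by rewrite subrr mulr0 addr0.
  by apply/ltW/supp => //; rewrite -ltnS.
have gap_sum : \sum_i l i * (H n + s * (i%:R - n%:R) - H i) =
               H n - \sum_i l i * H i.
  under eq_bigr => i _.
    rewrite (_ : _ * _ = (H n - s * n%:R) * l i + s * (l i * i%:R) - l i * H i);
      last by lra.
    over.
  rewrite sumrB big_split /= -!mulr_sumr l_sum l_mean; lra.
have gap0 : \sum_i l i * (H n + s * (i%:R - n%:R) - H i) = 0.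
  by apply/eqP; rewrite eq_le sumr_ge0 // andbT gap_sum; lra.
have l0 (i : 'I_b.+1) : (i : nat) != n -> l i = 0.
  move=> ne_in; apply/eqP.
  have /eqP := psumr_eq0P (fun i _ => gap_ge0 i) gap0 (i := i) isT.
  have := supp i ltac:(by rewrite -ltnS) ne_in.
  by rewrite mulf_eq0 => lt_H /orP[//|/eqP]; lra.
have lt_nb : (n < b.+1)%N by [].
have ne_ord (i : 'I_b.+1) : i != Ordinal lt_nb -> l i = 0 by move=> ?; apply: l0.
have l1 : l (Ordinal lt_nb) = 1.
  by rewrite -l_sum (bigD1 (Ordinal lt_nb)) //= big1 ?addr0.
have Un : opt_value I c n = (H n)%:E.
  rewrite -l_val (bigD1 (Ordinal lt_nb)) //= big1 ?adde0 ?l1 ?mul1e //.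
  by move=> i /ne_ord ->; rewrite mul0e.
have [|[S [cS sS]]] := opt_value_attained I c n; rewrite Un // => -[eqH].
by exists S.
Qed.

(** * Sets of [n] values without r-feasible pairs *)

Lemma pair_value_ge (T : finType) (A : {set T}) (x : T -> rat) (h : rat) i j :
  (forall k, k \in A -> x k <= h) -> i \in A -> j \in A -> i != j ->
  \sum_(k in A) x k - (#|A|%:R - 2) * h <= x i + x j.
Proof.
move=> x_le iA jA ne_ij.
have jAi : j \in A :\ i by rewrite !inE eq_sym ne_ij.
rewrite (big_setD1 i iA) (big_setD1 j jAi) /= (cardsD1 i A) iA.
rewrite (cardsD1 j (A :\ i)) jAi addnA natrD -[(true + true)%N]/2%N.
suff : \sum_(k in (A :\ i) :\ j) x k <= #|(A :\ i) :\ j|%:R * h by lra.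
rewrite mulr_natl -sumr_const; apply: ler_sum => k.
by rewrite !inE => /and3P[_ _]; apply: x_le.
Qed.

Lemma two_others (T : finType) (A : {set T}) y : (3 <= #|A|)%N -> y \in A ->
  exists i j, [/\ i \in A, j \in A, i != j, y != i & y != j].
Proof.
move=> cA yA; have /card_gt1P : (1 < #|A :\ y|)%N by have := cardsD1 y A; lia.
move=> [i [j [+ + ne_ij]]]; rewrite !inE => /andP[ne_iy iA] /andP[ne_jy jA].
by exists i, j; split=> //; rewrite eq_sym.
Qed.

(** Of the two terms of the minimum, the first is the average over [A] when [O]
    is empty and the second bounds the average over [A :\: O] when [O] is a
    singleton. *)
Lemma average_bound (T : finType) (A O : {set T}) (x : T -> rat) (r h B : rat) :
  (1 < #|A|)%N -> O \subset A -> (#|O| <= 1)%N ->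
  (forall o, o \in O -> x o <= r) ->
  (forall y, y \in A -> y \notin O -> x y + h <= B) ->
  h + Num.min ((\sum_(i in A) x i) / #|A|%:R)
              ((\sum_(i in A) x i - r) / (#|A|%:R - 1)) <= B.
Proof.
move=> cA subOA cO x_le_r x_le_B; set X := \sum_(i in A) x i.
have A_gt1 : 1 < #|A|%:R :> rat by rewrite ltr1n.
have sum_le (E : {set T}) : E \subset A -> [disjoint E & O] ->
    \sum_(i in E) x i <= #|E|%:R * (B - h).
  move=> /subsetP sEA dEO; rewrite mulr_natl -sumr_const.
  apply: ler_sum => y yE; have := x_le_B y (sEA _ yE).
  by rewrite (disjointFr dEO yE) => /(_ isT); lra.
rewrite -lerBrDl ge_min.
case: (posnP #|O|) => [/eqP|O_gt0].
  rewrite cards_eq0 => /eqP O0; apply/orP; left.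
  rewrite ler_pdivrMr; last by lra.
  rewrite mulrC; apply: sum_le => //.
  by rewrite O0 disjoint_sym disjoints_subset sub0set.
have /cards1P[o eqO] : #|O| == 1%N by rewrite eqn_leq cO.
have oO : o \in O by rewrite eqO set11.
have oA : o \in A := subsetP subOA o oO.
apply/orP; right; rewrite ler_pdivrMr; last by lra.
have := sum_le (A :\ o) (subD1set _ _).
rewrite {1}eqO disjoint_sym disjoints1 !inE eqxx /= => /(_ isT).
have := cardsD1 o A; rewrite oA => /(congr1 (fun k => k%:R : rat)).
rewrite natrD => ->; rewrite /X (big_setD1 o oA) /=.
by have := x_le_r o oO; lra.
Qed.

(** * The bound at r-vertices *)

Section VertexBound.
Variables (bw br : nat) (Hw Hr : nat -> rat).
Hypotheses (Hw_target : target_seq bw Hw) (Hr_target : target_seq br Hr).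
Variable n : nat.
Hypotheses (n_ge3 : (3 <= n)%N) (n_vertex : vertex bw Hw n).
Hypothesis small_pairs : bar br Hr 2 < Hw n - (n%:R - 2) * Hw 1%N.

Let rho1_bar : (0 < br)%N -> rho br Hr 1 = bar br Hr 1.
Proof.
case: Hr_target => H0 _ _ br_gt0; rewrite /rho /bar br_gt0 H0 subr0.
by rewrite (minn_idPl _).
Qed.

Let bar_w1 : bar bw Hw 1 = Hw 1%N.
Proof. by rewrite /bar (minn_idPl _) //; case: n_vertex => /andP[_]; lia. Qed.

Lemma realizable_vertex_bound m : realizable bw br Hw Hr -> vertex br Hr m ->
  Hr m + Num.min (Hw n / n%:R) ((Hw n - rho br Hr 1) / (n%:R - 1))
    <= bar bw Hw m.+1.
Proof.
move=> [I [hull_w hull_r]] m_vertex.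
have [X [cX sX vX]] := vertex_attained Hw_target hull_w n_vertex.
have [Z [cZ sZ vZ]] := vertex_attained Hr_target hull_r m_vertex.
have x_le i : i \in X -> ival i <= Hw 1%N.
  move=> iX; have := total_value_le_bar (S := [set i]) hull_w.
  rewrite /total_value /total_size !big_set1 cards1 bar_w1; apply.
  exact: isize_leD.
have no_pair i j : i \in X -> j \in X -> i != j ->
    (capR I < total_size [set i; j])%N.
  move=> iX jX ne_ij; rewrite ltnNge; apply/negP => /(total_value_le_bar hull_r).
  have := pair_value_ge x_le iX jX ne_ij.
  rewrite -/(total_value X) vX cX cards2 ne_ij -[true.+1]/2%N /total_value.
  rewrite big_setU1 ?big_set1 ?inE //= => ge_pair.
  by move/(le_trans ge_pair); rewrite leNgt small_pairs.
have size_mono (S S' : {set I}) : S \subset S' ->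
    (total_size S <= total_size S')%N.
  move=> sub; rewrite /total_size [leqRHS](big_setID S) /= (setIidPr sub).
  exact: leq_addr.
have sizeU1 y (S : {set I}) : y \notin S ->
    total_size (y |: S) = (isize y + total_size S)%N.
  by move=> yS; rewrite /total_size big_setU1.
rewrite -vX -cX; apply: (average_bound (O := X :&: Z)).
- by rewrite cX; lia.
- exact: subsetIl.
- rewrite leqNgt; apply/negP => /card_gt1P[i [j]].
  rewrite !inE => -[/andP[iX iZ] /andP[jX jZ] ne_ij].
  have subZ : [set i; j] \subset Z by rewrite subUset !sub1set iZ.
  by have := no_pair i j iX jX ne_ij; have := size_mono _ _ subZ; lia.
- move=> o /setIP[_ oZ].
  have subZ : [set o] \subset Z by rewrite sub1set.
  have := total_value_le_bar hull_r (leq_trans (size_mono _ _ subZ) sZ).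
  rewrite cards1 /total_value big_set1 rho1_bar //.
  by case: m_vertex => /andP[]; lia.
- move=> y yX; rewrite inE yX /= => yZ.
  (* Two more items of [X] together exceed [R], so adding [y] to [Z] costs no
     more than these two and [y], which fit into [D] as part of [X]. *)
  have [i [j [iX jX ne_ij ne_yi ne_yj]]] :=
    two_others (A := X) ltac:(by rewrite cX) yX.
  have subX : y |: [set i; j] \subset X by rewrite !subUset !sub1set yX iX.
  have := total_value_le_bar (S := y |: Z) hull_w.
  rewrite cardsU1 yZ cZ add1n /total_value big_setU1 //= -/(total_value Z) vZ.
  apply; have := size_mono _ _ subX; have := no_pair i j iX jX ne_ij.
  rewrite !sizeU1 ?inE ?negb_or ?ne_yi //.
  by move: sX sZ; lia.
Qed.

Lemma exchange_vertex_bound m : exchange_closure bw br Hw Hr -> vertex br Hr m ->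
  Hr m + Num.min (Hw n / n%:R) ((Hw n - rho br Hr 1) / (n%:R - 1))
    <= bar bw Hw m.+1.
Proof.
move=> [_ [W [Xn _ XZ]]] m_vertex.
have [[_ F_down _] [x_bnd x_short x_sum _ F_bnd]] := Xn n n_vertex.
have [O_F [_ O_short _] _ ec5] := XZ n m n_vertex m_vertex.
have x_sumT : \sum_(i in [set: 'I_n]) wit_x W i = Hw n.
  by rewrite -x_sum; apply: eq_bigl => i; rewrite inE.
have cT : #|[set: 'I_n]| = n by rewrite cardsT card_ord.
have x_le i : i \in [set: 'I_n] -> wit_x W i <= Hw 1%N.
  by move=> _; have /andP[] := x_bnd i.
have no_pair (i j : 'I_n) : i != j -> [set i; j] \notin wit_F W n.
  move=> ne_ij; apply/negP => /F_bnd.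
  have := pair_value_ge x_le (in_setT i) (in_setT j) ne_ij.
  rewrite x_sumT cT cards2 ne_ij -[true.+1]/2%N.
  rewrite big_setU1 ?big_set1 ?inE //= => ge_pair.
  by move/(le_trans ge_pair); rewrite leNgt small_pairs.
have := @average_bound _ [set: 'I_n] (wit_O W n m) (fun i => wit_x W i)
  (rho br Hr 1) (Hr m) (bar bw Hw m.+1).
rewrite x_sumT cT; apply.
- by lia.
- exact: subsetT.
- rewrite leqNgt; apply/negP => /card_gt1P[i [j [iO jO ne_ij]]].
  have /negP := no_pair i j ne_ij; apply; apply: F_down O_F.
  by rewrite subUset !sub1set iO.
- by move=> o /O_short/x_short.
- move=> y _ yO.
  have [i [j [_ _ ne_ij ne_yi ne_yj]]] :=
    two_others (A := [set: 'I_n]) ltac:(by rewrite cT) (in_setT y).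
  apply: ec5 (ne_ij) (no_pair i j ne_ij) _ _.
  by rewrite !inE !negb_or ne_yi ne_yj.
Qed.

End VertexBound.

Theorem corollary3p5 (bw br : nat) (Hw Hr : nat -> rat)
    (Hw_target : target_seq bw Hw) (Hr_target : target_seq br Hr)
    (n : nat) (n_ge3 : (3 <= n)%N) (n_vertex : vertex bw Hw n)
    (small_pairs : bar br Hr 2 < Hw n - (n%:R - 2) * Hw 1%N)
    (real_or_EC : realizable bw br Hw Hr \/ exchange_closure bw br Hw Hr)
    (m : nat) (m_le : (m <= br)%N) :
  Hr m + Num.min (Hw n / n%:R) ((Hw n - rho br Hr 1) / (n%:R - 1))
    <= bar bw Hw m.+1.
Proof.
set c := Num.min _ _.
have at_vertex k : vertex br Hr k -> Hr k + c <= bar bw Hw k.+1.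
  move=> k_vertex; case: real_or_EC => [real|ec].
    exact: realizable_vertex_bound.
  exact: exchange_vertex_bound.
suff : c <= bar bw Hw m.+1 - Hr m by lra.
apply: (ge_of_locally_concave (f := fun k => bar bw Hw k.+1 - Hr k) (b := br)) m_le.
- have [/andP[_ le_nb] _] := n_vertex.
  have [Hw0 _ _] := Hw_target; have [Hr0 _ _] := Hr_target.
  rewrite /bar (minn_idPl _) ?Hr0 ?subr0; last by lia.
  rewrite /c ge_min; apply/orP; left.
  rewrite ler_pdivrMr; last by rewrite ltr0n; lia.
  have := forward_chord (i := 0) (k := n) Hw_target.
  by rewrite Hw0 add0n => /(_ le_nb ltac:(lia)); lra.
- move=> k k_bnd.
  have [eq_k|ne_k] := eqVneq k br.
    by left; have := at_vertex k (conj k_bnd (or_introl eq_k)); lra.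
  have [eq_sl|ne_sl] := eqVneq (Hr k - Hr k.-1) (Hr k.+1 - Hr k).
    right; split; first by lia.
    have := bar_concave k Hw_target; have -> : k.-1.+1 = k by lia.
    by lra.
  by left; have := at_vertex k (conj k_bnd (or_intror (elimN eqP ne_sl))); lra.
Qed.
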